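(* Let $M$ be a semi-slant submanifold of a locally metallic (or, for $p=q=1$, locally Golden) Riemannian manifold $(\overline{M},\overline{g},J)$, with invariant distribution $D_1$ and slant distribution $D_2$. If $\nabla T=0$, then the distributions $D_1$ and $D_2$ are integrable.
   Context: $p,q$ are positive integers. A metallic Riemannian manifold $(\overline{M},\overline{g},J)$ is a Riemannian manifold with a $(1,1)$-tensor field $J$ such that $J^2=pJ+qI$ and $\overline{g}(JX,Y)=\overline{g}(X,JY)$ for all vector fields $X,Y$; it is Golden if $p=q=1$. It is locally metallic (locally Golden) if moreover $\overline{\nabla}J=0$, where $\overline{\nabla}$ is the Levi-Civita connection of $\overline{g}$. $M$ is an $m'$-dimensional submanifold isometrically immersed in the $m$-dimensional manifold $\overline{M}$, $m>m'\ge1$, and $\nabla$ is the Levi-Civita connection of the induced metric on $M$. For $X\in\Gamma(TM)$, $TX$ is the tangential part of $JX$, and $(\nabla_XT)Y=\nabla_XTY-T(\nabla_XY)$ for $X,Y\in\Gamma(TM)$. $M$ is a semi-slant submanifold if there are orthogonal distributions $D_1,D_2$ on $M$ with $TM=D_1\oplus D_2$, $J(D_1)=D_1$, and $D_2$ slant with angle $\theta\neq0$, i.e. the angle between $JX_x$ and $(D_2)_x$ is a constant $\theta\ne0$ for all $x\in M$ and nonzero $X_x\in(D_2)_x$. *)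

(* Defs.v *)
From HB Require Import structures.
From mathcomp Require Import all_boot all_order all_algebra.
From mathcomp Require Import ring.
From mathcomp Require Import all_classical all_reals all_analysis.
Set Implicit Arguments.
Unset Strict Implicit.
Unset Printing Implicit Defensive.
Import Order.TTheory GRing.Theory Num.Theory.
Import numFieldNormedType.Exports.
Local Open Scope classical_set_scope.
Local Open Scope ring_scope.

Section smooth_euclidean.
Context {R : realType} {n : nat}.
Implicit Types (U : set 'rV[R]_n) (f g : 'rV[R]_n -> R).

(* Class C^k on U, meant for open U: the iterated partial derivatives of order
   at most k exist and are continuous at the points of U. *)
Fixpoint Ck (k : nat) U f : Prop :=
  (forall x, U x -> {for x, continuous f}) /\
  (if k is k'.+1 then forall i : 'I_n,
     (forall x, U x -> derivable f x (delta_mx 0 i)) /\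
     Ck k' U (fun x => 'D_(delta_mx 0 i) f x)
   else True).

Definition smooth_on U f : Prop := forall k, Ck k U f.

Lemma CkS_le k U f : Ck k.+1 U f -> Ck k U f.
Proof.
elim: k f => [|k IH] f [cf df]; split => // i.
by have [dif /IH Dif] := df i; split.
Qed.

Lemma Ck_ext k U f g : open U -> (forall x, U x -> f x = g x) ->
  Ck k U f -> Ck k U g.
Proof.
move=> oU; have nearU h1 h2 x : (forall x, U x -> h1 x = h2 x) -> U x ->
    \near x, h1 x = h2 x :> R.
  by move=> e Ux; move: (open_nbhs_nbhs (conj oU Ux)); apply: filterS.
have cont (h1 h2 : _ -> R) : (forall x, U x -> h1 x = h2 x) ->
    (forall x, U x -> {for x, continuous h1}) ->
    forall x, U x -> {for x, continuous h2}.
  move=> e c x Ux; have := c x Ux.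
  rewrite /prop_for /continuous_at -(e x Ux); apply: cvg_trans.
  exact: near_eq_cvg (nearU _ _ _ e Ux).
elim: k f g => [|k IH] f g fg [cf df]; split; [exact: cont cf| |exact: cont cf|].
  by [].
move=> i; have [dif Dif] := df i; split => [x Ux|].
  exact: near_eq_derivable (nearU _ _ _ fg Ux) (dif x Ux).
by apply: IH Dif => x Ux; exact: near_eq_derive (nearU _ _ _ fg Ux).
Qed.

Lemma Ck_cst k U (a : R) : open U -> Ck k U (cst a).
Proof.
move=> oU; elim: k a => [|k IH] a; split=> //; try by move=> ? _; exact: cst_continuous.
move=> i; split=> [x _|]; first exact: derivable_cst.
by apply: (Ck_ext oU _ (IH 0)) => x _; rewrite derive_cst.
Qed.

Lemma Ck_sub k U f g : open U -> Ck k U f -> Ck k U g -> Ck k U (f - g).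
Proof.
move=> oU; elim: k f g => [|k IH] f g [cf df] [cg dg]; split=> //;
  try by move=> x Ux; apply: continuousB; [exact: cf|exact: cg].
move=> i; have [dif Dif] := df i; have [dig Dig] := dg i.
split=> [x Ux|]; first by apply: derivableB; [exact: dif|exact: dig].
apply: (Ck_ext oU _ (IH _ _ Dif Dig)) => x Ux.
by rewrite deriveB//; [exact: dif|exact: dig].
Qed.

Lemma Ck_opp k U f : open U -> Ck k U f -> Ck k U (- f).
Proof. by move=> oU Cf; rewrite -sub0r; apply: Ck_sub => //; exact: Ck_cst. Qed.

Lemma Ck_add k U f g : open U -> Ck k U f -> Ck k U g -> Ck k U (f + g).
Proof.
by move=> oU Cf Cg; rewrite -[g]opprK; apply: Ck_sub => //; exact: Ck_opp.
Qed.

Lemma Ck_mul k U f g : open U -> Ck k U f -> Ck k U g -> Ck k U (f * g).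
Proof.
move=> oU; elim: k f g => [|k IH] f g Cf Cg.
  case: Cf Cg => [cf _] [cg _]; split=> // x Ux.
  by apply: continuousM; [exact: cf|exact: cg].
have := CkS_le Cf; have := CkS_le Cg.
case: Cf Cg => [cf df] [cg dg] Cg' Cf'; split=> [x Ux|i].
  by apply: continuousM; [exact: cf|exact: cg].
have [dif Dif] := df i; have [dig Dig] := dg i.
split=> [x Ux|]; first by apply: derivableM; [exact: dif|exact: dig].
apply: (Ck_ext oU _ (Ck_add oU (IH _ _ Cf' Dig) (IH _ _ Cg' Dif))) => x Ux.
by rewrite deriveM//; [exact: dif|exact: dig].
Qed.

End smooth_euclidean.

Record chart (R : realType) (n : nat) (T : topologicalType) := Chart {
  chart_dom : set T;
  chart_img : set 'rV[R]_n;
  chart_map : T -> 'rV[R]_n;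
  chart_inv : 'rV[R]_n -> T;
  chart_dom_open : open chart_dom;
  chart_img_open : open chart_img;
  chart_mapP : forall x, chart_dom x -> chart_img (chart_map x);
  chart_invP : forall u, chart_img u -> chart_dom (chart_inv u);
  chart_mapK : forall x, chart_dom x -> chart_inv (chart_map x) = x;
  chart_invK : forall u, chart_img u -> chart_map (chart_inv u) = u;
  chart_map_continuous : {within chart_dom, continuous chart_map};
  chart_inv_continuous : {within chart_img, continuous chart_inv} }.

(* The atlas need not be maximal; it determines the smooth structure. *)
Record manifold (R : realType) (n : nat) := Manifold {
  mf_carrier :> topologicalType;
  mf_hausdorff : hausdorff_space mf_carrier;
  mf_second_countable : @second_countable mf_carrier;
  mf_atlas : set (chart R n mf_carrier);
  mf_cover : forall x, exists2 c, mf_atlas c & chart_dom c x;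
  mf_compat : forall c d, mf_atlas c -> mf_atlas d -> forall j : 'I_n,
    smooth_on (chart_img c `&` chart_inv c @^-1` chart_dom d)
              (fun u => chart_map d (chart_inv c u) 0 j) }.

Section smooth_functions.
Context {R : realType} {n : nat} (M : manifold R n).

Definition smooth (f : M -> R) : Prop :=
  forall c, mf_atlas c -> smooth_on (chart_img c) (f \o chart_inv c).

Lemma smooth_const (a : R) : smooth (cst a).
Proof. by move=> c _ k; apply: Ck_cst; exact: chart_img_open. Qed.

Lemma smooth_sub (f g : M -> R) : smooth f -> smooth g -> smooth (f - g).
Proof.
move=> sf sg c Mc k.
by apply: Ck_sub; [exact: chart_img_open|exact: sf|exact: sg].
Qed.

Lemma smooth_mul (f g : M -> R) : smooth f -> smooth g -> smooth (f * g).
Proof.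
move=> sf sg c Mc k.
by apply: Ck_mul; [exact: chart_img_open|exact: sf|exact: sg].
Qed.

Lemma smooth_add (f g : M -> R) : smooth f -> smooth g -> smooth (f + g).
Proof.
move=> sf sg c Mc k.
by apply: Ck_add; [exact: chart_img_open|exact: sf|exact: sg].
Qed.

Definition smooth_pred : {pred (M -> R)} := mem [set f | smooth f].

Lemma smooth_predP f : reflect (smooth f) (f \in smooth_pred).
Proof. by apply: (iffP idP) => [/set_mem|/mem_set]. Qed.

Fact smooth_subring : subring_closed smooth_pred.
Proof.
split=> [|f g /smooth_predP sf /smooth_predP sg
         |f g /smooth_predP sf /smooth_predP sg]; apply/smooth_predP.
- exact: smooth_const.
- exact: smooth_sub.
- exact: smooth_mul.
Qed.
HB.instance Definition _ :=
  GRing.isSubringClosed.Build (M -> R) smooth_pred smooth_subring.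

(* The ring C^oo(M). *)
Record smoothFun := SmoothFun {
  sf_val :> M -> R;
  sf_in : sf_val \in smooth_pred }.
HB.instance Definition _ := [isSub for sf_val].
HB.instance Definition _ := [Choice of smoothFun by <:].
HB.instance Definition _ := 
  GRing.SubChoice_isSubComPzRing.Build (M -> R) smooth_pred smoothFun
    smooth_subring.

Lemma sf_smooth (f : smoothFun) : smooth f.
Proof. by apply/smooth_predP; exact: sf_in. Qed.

Definition mk_smoothFun (f : M -> R) (sf : smooth f) : smoothFun :=
  SmoothFun (introT (smooth_predP f) sf).

Definition sf_cst (a : R) : smoothFun := mk_smoothFun (smooth_const a).

Lemma smoothFun_eq (f g : smoothFun) : (forall x, f x = g x) -> f = g.
Proof. by move=> fg; apply/val_inj/funext. Qed.

Definition derivation_at (x : M) (v : smoothFun -> R) : Prop :=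
  [/\ forall f g, v (f + g) = v f + v g,
      forall (a : R) f, v (sf_cst a * f) = a * v f &
      forall f g, v (f * g) = f x * v g + g x * v f].

Definition derivation_pred (x : M) : {pred (smoothFun -> R^o)} :=
  mem [set v | derivation_at x v].

Lemma derivation_predP x v :
  reflect (derivation_at x v) (v \in derivation_pred x).
Proof. by apply: (iffP idP) => [/set_mem|/mem_set]. Qed.

Fact derivation_submod x : submod_closed (derivation_pred x).
Proof.
split=> [|a u v /derivation_predP[uD uZ uM] /derivation_predP[vD vZ vM]];
  apply/derivation_predP; split=> [f g|b f|f g].
- by rewrite /= addr0.
- by rewrite /= mulr0.
- by rewrite /= !mulr0 addr0.
- change (a * u (f + g)%R + v (f + g)%R = a * u f + v f + (a * u g + v g)).
  by rewrite uD vD; ring.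
- change (a * u (sf_cst b * f) + v (sf_cst b * f) = b * (a * u f + v f)).
  by rewrite uZ vZ; ring.
- change (a * u (f * g)%R + v (f * g)%R =
          f x * (a * u g + v g) + g x * (a * u f + v f)).
  by rewrite uM vM; ring.
Qed.
HB.instance Definition _ x :=
  GRing.isSubmodClosed.Build R (smoothFun -> R^o) (derivation_pred x)
    (derivation_submod x).

(* The tangent space at x, as the space of derivations of C^oo(M) at x. *)
Record tangent (x : M) := Tangent {
  tv_val :> smoothFun -> R^o;
  tv_in : tv_val \in derivation_pred x }.
HB.instance Definition _ x := [isSub for @tv_val x].
HB.instance Definition _ x := [Choice of tangent x by <:].
HB.instance Definition _ x := [SubChoice_isSubLmodule of tangent x by <:].

Lemma tvP x (v : tangent x) : derivation_at x v.
Proof. by apply/derivation_predP; exact: tv_in. Qed.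

Definition mk_tangent x (v : smoothFun -> R^o) (dv : derivation_at x v) :
  tangent x := Tangent (introT (derivation_predP x v) dv).

Lemma tangent_eq x (u v : tangent x) : (forall f, u f = v f) -> u = v.
Proof. by move=> uv; apply/val_inj/funext. Qed.

Record vfield := VField {
  vf_val :> forall x : M, tangent x;
  vf_smooth : forall f : smoothFun, smooth (fun x => vf_val x f) }.
HB.instance Definition _ := gen_eqMixin vfield.
HB.instance Definition _ := gen_choiceMixin vfield.

Definition vf_app (X : vfield) (f : smoothFun) : smoothFun :=
  mk_smoothFun (vf_smooth X f).

Lemma vfield_eq (X Y : vfield) : (forall x, X x = Y x) -> X = Y.
Proof.
case: X Y => [X sX] [Y sY] /= XY; have {}XY : X = Y by apply: functional_extensionality_dep.
by case: _ / XY sY => sY; congr VField; exact: Prop_irrelevance.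
Qed.

End smooth_functions.
Arguments mk_smoothFun {R n M f}.
Arguments tangent {R n} M x.
Arguments mk_tangent {R n M x} v.
Arguments sf_cst {R n} M a.

(* vfield M is a module over C^oo(M); all operations are pointwise. *)
Section vfield_module.
Context {R : realType} {n : nat} {M : manifold R n}.
Implicit Types (X Y Z : vfield M) (f g : smoothFun M).

Definition vf0 : vfield M :=
  @VField _ _ M (fun x => 0) (fun f => smooth_const 0).
Definition vf_add X Y : vfield M :=
  @VField _ _ M (fun x => X x + Y x)
    (fun f => smooth_add (vf_smooth X f) (vf_smooth Y f)).
Definition vf_scale f X : vfield M :=
  @VField _ _ M (fun x => f x *: X x)
    (fun h => smooth_mul (sf_smooth f) (vf_smooth X h)).
Definition vf_opp X : vfield M := vf_scale (- 1) X.

Fact vf_addA : associative vf_add.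
Proof. by move=> X Y Z; apply: vfield_eq => x /=; rewrite addrA. Qed.
Fact vf_addC : commutative vf_add.
Proof. by move=> X Y; apply: vfield_eq => x /=; rewrite addrC. Qed.
Fact vf_add0 : left_id vf0 vf_add.
Proof. by move=> X; apply: vfield_eq => x /=; rewrite add0r. Qed.
Fact vf_addN : left_inverse vf0 vf_opp vf_add.
Proof.
move=> X; apply: vfield_eq => x.
by change ((- 1 : R) *: X x + X x = 0); rewrite scaleN1r addNr.
Qed.
HB.instance Definition _ :=
  GRing.isZmodule.Build (vfield M) vf_addA vf_addC vf_add0 vf_addN.

Fact vf_scaleA f g X : vf_scale f (vf_scale g X) = vf_scale (f * g) X.
Proof. by apply: vfield_eq => x /=; rewrite scalerA. Qed.
Fact vf_scale1 : left_id 1 vf_scale.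
Proof. by move=> X; apply: vfield_eq => x /=; rewrite scale1r. Qed.
Fact vf_scaleDr : right_distributive vf_scale +%R.
Proof. by move=> f X Y; apply: vfield_eq => x /=; rewrite scalerDr. Qed.
Fact vf_scaleDl X : {morph vf_scale^~ X : f g / f + g}.
Proof. by move=> f g; apply: vfield_eq => x /=; rewrite scalerDl. Qed.
HB.instance Definition _ := GRing.Zmodule_isLmodule.Build (smoothFun M)
  (vfield M) vf_scaleA vf_scale1 vf_scaleDr vf_scaleDl.

Fact lie_derivation X Y x :
  derivation_at x (fun f => X x (vf_app Y f) - Y x (vf_app X f)).
Proof.
have appD Z f g : vf_app Z (f + g) = vf_app Z f + vf_app Z g.
  by apply: smoothFun_eq => y /=; have [-> _ _] := tvP (Z y).
have appZ Z a f : vf_app Z (sf_cst M a * f) = sf_cst M a * vf_app Z f.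
  by apply: smoothFun_eq => y /=; have [_ -> _] := tvP (Z y).
have appM Z f g : vf_app Z (f * g) = f * vf_app Z g + g * vf_app Z f.
  by apply: smoothFun_eq => y /=; have [_ _ ->] := tvP (Z y).
have [XD XZ XM] := tvP (X x); have [YD YZ YM] := tvP (Y x).
split=> [f g|a f|f g].
- by rewrite !appD XD YD opprD addrACA.
- by rewrite !appZ XZ YZ mulrBr.
- rewrite !appM XD YD !XM !YM /=.
  ring.
Qed.

Definition lie_bracket X Y : vfield M :=
  @VField _ _ M (fun x => mk_tangent _ (lie_derivation X Y x))
    (fun f => smooth_sub (vf_smooth X (vf_app Y f)) (vf_smooth Y (vf_app X f))).

End vfield_module.

Section tensors_and_connections.
Context {R : realType} {n : nat} (M : manifold R n).
Implicit Types (X Y Z : vfield M) (f : smoothFun M).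

(* A smooth (1,1)-tensor field. *)
Record tensor11 := Tensor11 {
  t11_val :> forall x : M, tangent M x -> tangent M x;
  t11_linear : forall x (a : R) (u v : tangent M x),
    t11_val (a *: u + v) = a *: t11_val u + t11_val v;
  t11_smooth : forall X f, smooth (fun x => t11_val (X x) f) }.

Definition t11_app (A : tensor11) X : vfield M :=
  @VField _ _ M (fun x => A x (X x)) (t11_smooth A X).

Record riemannian_metric := Metric {
  metric_val :> forall x : M, tangent M x -> tangent M x -> R;
  metric_linear : forall x (a : R) (u v w : tangent M x),
    metric_val (a *: u + v) w = a * metric_val u w + metric_val v w;
  metric_sym : forall x (u v : tangent M x), metric_val u v = metric_val v u;
  metric_pos : forall x (u : tangent M x), u != 0 -> 0 < metric_val u u;
  metric_smooth : forall X Y, smooth (fun x => metric_val (X x) (Y x)) }.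

Definition metric_app (g : riemannian_metric) X Y : smoothFun M :=
  mk_smoothFun (metric_smooth g X Y).

Record connection := Connection {
  nabla :> vfield M -> vfield M -> vfield M;
  nabla_linear : forall f X X' Y,
    nabla (f *: X + X') Y = f *: nabla X Y + nabla X' Y;
  nabla_add : forall X Y Y', nabla X (Y + Y') = nabla X Y + nabla X Y';
  nabla_leibniz : forall X f Y,
    nabla X (f *: Y) = vf_app X f *: Y + f *: nabla X Y }.

Definition levi_civita (g : riemannian_metric) (D : connection) : Prop :=
  (forall X Y, D X Y - D Y X = lie_bracket X Y) /\
  (forall X Y Z, vf_app X (metric_app g Y Z) =
     metric_app g (D X Y) Z + metric_app g Y (D X Z)).

(* (D_X A) Y *)
Definition nabla_t11 (D : connection) (A : tensor11) X Y : vfield M :=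
  D X (t11_app A Y) - t11_app A (D X Y).

Definition parallel (D : connection) (A : tensor11) : Prop :=
  forall X Y, nabla_t11 D A X Y = 0.

Definition metallic (p q : nat) (g : riemannian_metric) (J : tensor11) : Prop :=
  (forall x (u : tangent M x), J x (J x u) = p%:R *: J x u + q%:R *: u) /\
  (forall x (u v : tangent M x), g x (J x u) v = g x u (J x v)).

(* Locally Golden is the case p = q = 1. *)
Definition locally_metallic (p q : nat) (g : riemannian_metric) (J : tensor11)
    (D : connection) : Prop :=
  [/\ metallic p q g J, levi_civita g D & parallel D J].

(* A smooth distribution of constant rank. The local frames are restrictions of
   global vector fields: every local frame extends, after shrinking its domain,
   by means of a cutoff function. *)
Record smooth_distribution := Distribution {
  dist_val :> forall x : M, set (tangent M x);
  dist_rank : nat;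
  dist_frame : forall x : M, exists E : 'I_dist_rank -> vfield M,
    \forall y \near x,
      (forall a : 'I_dist_rank -> R,
         \sum_i a i *: E i y = 0 -> forall i, a i = 0) /\
      @dist_val y =
        [set v | exists a : 'I_dist_rank -> R, v = \sum_i a i *: E i y] }.

Definition section_of (D : smooth_distribution) X : Prop := forall x, D x (X x).

(* Integrability in the sense of the Lie bracket. *)
Definition integrable_distribution (D : smooth_distribution) : Prop :=
  forall X Y, section_of D X -> section_of D Y ->
    section_of D (lie_bracket X Y).

End tensors_and_connections.

(* theta in [0, pi/2] is the angle between u <> 0 and the subspace W, i.e.
   between u and its orthogonal projection w onto W (pi/2 when w = 0). *)
Definition angle_subspace (R : realType) (V : lmodType R) (ip : V -> V -> R)
    (u : V) (W : set V) (theta : R) : Prop :=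
  exists2 w, W w /\ (forall w', W w' -> ip (u - w) w' = 0) &
    theta = acos (Num.sqrt (ip w w) / Num.sqrt (ip u u)).

Section submanifolds.
Context {R : realType} {m' m : nat} {M : manifold R m'} {N : manifold R m}.

(* A map between manifolds is C^oo iff it pulls C^oo functions back to C^oo
   functions. *)
Record smoothMap := SmoothMap {
  sm_val :> M -> N;
  sm_smooth : forall h : smoothFun N, smooth (h \o sm_val) }.

Definition pullback (phi : smoothMap) (h : smoothFun N) : smoothFun M :=
  mk_smoothFun (sm_smooth phi h).

Fact differential_derivation (phi : smoothMap) x (v : tangent M x) :
  derivation_at (phi x) (fun h => v (pullback phi h)).
Proof.
have [vD vZ vM] := tvP v; split=> [f g|a f|f g].
- by rewrite -vD; congr (tv_val v _); exact: smoothFun_eq.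
- by rewrite -vZ; congr (tv_val v _); exact: smoothFun_eq.
- have -> : pullback phi (f * g) = pullback phi f * pullback phi g.
    exact: smoothFun_eq.
  exact: vM.
Qed.

Definition differential (phi : smoothMap) x (v : tangent M x) :
  tangent N (phi x) := mk_tangent _ (differential_derivation phi v).

Definition isometric_immersion (g : riemannian_metric M) (gbar : riemannian_metric N)
    (phi : smoothMap) : Prop :=
  (forall x, injective (@differential phi x)) /\
  (forall x (u v : tangent M x),
     g x u v = gbar (phi x) (differential phi u) (differential phi v)).

(* T u is the tangential part of J u. *)
Definition tangential_part (gbar : riemannian_metric N) (J : tensor11 N) (phi : smoothMap)
    (T : tensor11 M) : Prop :=
  forall x (u v : tangent M x),
    gbar (phi x) (J (phi x) (differential phi u) - differential phi (T x u))
      (differential phi v) = 0.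

Definition invariant_distribution (J : tensor11 N) (phi : smoothMap)
    (D : smooth_distribution M) : Prop :=
  forall x, J (phi x) @` (@differential phi x @` D x) =
            @differential phi x @` D x.

Definition slant_distribution (gbar : riemannian_metric N) (J : tensor11 N)
    (phi : smoothMap) (D : smooth_distribution M) (theta : R) : Prop :=
  forall x (u : tangent M x), D x u -> u != 0 ->
    angle_subspace (gbar (phi x)) (J (phi x) (differential phi u))
      (@differential phi x @` D x) theta.

Definition semi_slant (g : riemannian_metric M) (gbar : riemannian_metric N) (J : tensor11 N)
    (phi : smoothMap) (D1 D2 : smooth_distribution M) (theta : R) : Prop :=
  [/\ forall x (u v : tangent M x), D1 x u -> D2 x v -> g x u v = 0,
      forall x (u : tangent M x),
        exists! v : tangent M x * tangent M x,
          [/\ D1 x v.1, D2 x v.2 & u = v.1 + v.2],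
      invariant_distribution J phi D1,
      slant_distribution gbar J phi D2 theta &
      theta != 0].

End submanifolds.
Arguments smoothMap {R m' m} M N.

(* Main.v *)
Require Import Defs.
From HB Require Import structures.
From mathcomp Require Import all_boot all_order all_algebra.
From mathcomp Require Import lra.
From mathcomp Require Import all_classical all_reals all_analysis.

(** Pointwise, the tangential part [T] of [J] is a symmetric endomorphism of
    the tangent space that preserves both distributions.  On [D1] it coincides
    with [J], so [T^2 = p T + q] there.  On [D2], [T u] is the orthogonal
    projection of [J u], so the slant condition reads
    [|T u|^2 = cos^2 theta |J u|^2]; as [|J u|^2 = g(p T u + q u, u)],
    polarisation turns this into [T^2 = c (p T + q)] with [c = cos^2 theta],
    and [c <> 1] because [theta <> 0] (if [D2 = 0], any [c <> 1] will do).

    The equations [T^2 u = a (p T u + q u)] for two distinct values of [a] have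
    only [u = 0] in common, since [p T u + q u = T^2 u = 0] forces [u = 0] when
    [q <> 0] ([quad_eigen_trivial]).  As [D1] and [D2] together span, they are
    therefore exactly the solution spaces for [a = 1] and [a = c]
    ([mem_quad_eigen]).

    Since [T] is parallel, the covariant derivative of a solution field is again
    a solution field, and hence so is its Lie bracket
    [D_X Y - D_Y X] with another one ([quad_eigen_integrable]).  Both
    distributions are thus kernels of parallel tensors, which gives the
    conclusion for the two of them by one argument. *)

Set Implicit Arguments.
Unset Strict Implicit.
Unset Printing Implicit Defensive.
Import Order.TTheory GRing.Theory Num.Theory.
Local Open Scope classical_set_scope.
Local Open Scope ring_scope.

(** * Linearity of tensors, differentials and metrics *)

HB.instance Definition _ (R : realType) (n : nat) (M : manifold R n)
    (A : tensor11 M) (x : M) :=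
  GRing.isLinear.Build R (tangent M x) (tangent M x) *:%R (A x)
    (fun a u v => t11_linear A a u v).

Fact differential_linear (R : realType) (m' m : nat) (M : manifold R m')
  (N : manifold R m) (phi : smoothMap M N) (x : M) :
  linear (@differential _ _ _ _ _ phi x).
Proof. by move=> a u v; apply: tangent_eq. Qed.

HB.instance Definition _ (R : realType) (m' m : nat) (M : manifold R m')
    (N : manifold R m) (phi : smoothMap M N) (x : M) :=
  GRing.isLinear.Build R (tangent M x) (tangent N (phi x)) *:%R
    (@differential _ _ _ _ _ phi x) (@differential_linear _ _ _ _ _ phi x).

Section metric.
Context {R : realType} {n : nat} {M : manifold R n} (g : riemannian_metric M).
Variable x : M.
Implicit Types u v w : tangent M x.

Lemma metricC u v : g x u v = g x v u.
Proof. exact: Defs.metric_sym. Qed.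

Lemma metricDl u v w : g x (u + v) w = g x u w + g x v w.
Proof. by have := metric_linear g 1 u v w; rewrite scale1r mul1r. Qed.

Lemma metric0l w : g x 0 w = 0.
Proof. by have := metricDl 0 0 w; rewrite addr0 => ?; lra. Qed.

Lemma metricZl a u w : g x (a *: u) w = a * g x u w.
Proof. by have := metric_linear g a u 0 w; rewrite addr0 metric0l addr0. Qed.

Lemma metricBl u v w : g x (u - v) w = g x u w - g x v w.
Proof. by rewrite metricDl -scaleN1r metricZl mulN1r. Qed.

Lemma metricDr u v w : g x w (u + v) = g x w u + g x w v.
Proof. by rewrite metricC metricDl !(metricC w). Qed.

Lemma metricBr u v w : g x w (u - v) = g x w u - g x w v.
Proof. by rewrite metricC metricBl !(metricC w). Qed.

Lemma metricZr a u w : g x w (a *: u) = a * g x w u.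
Proof. by rewrite metricC metricZl (metricC w). Qed.

Lemma metric_eq0 u : g x u u = 0 -> u = 0.
Proof.
by move=> guu; apply/eqP; apply: contraT => /(metric_pos g); rewrite guu ltxx.
Qed.

Lemma metric_ge0 u : 0 <= g x u u.
Proof. by have [->|/(metric_pos g)/ltW //] := eqVneq u 0; rewrite metric0l. Qed.

(** * Symmetric endomorphisms and angles *)

(** Polarisation, in the form that applies to an endomorphism [L] of a
    subspace: the hypothesis at [u + L u] expands to [2 |L u|^2 = 0]. *)
Lemma symmetric_form_eq0 (W : set (tangent M x))
    (L : {linear tangent M x -> tangent M x}) :
  (forall u v, W u -> W v -> W (u + v)) ->
  (forall u, W u -> W (L u)) ->
  (forall u v, g x (L u) v = g x u (L v)) ->
  (forall u, W u -> g x (L u) u = 0) ->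
  forall u, W u -> L u = 0.
Proof.
move=> WD WL Lsym L0 u Wu; apply: metric_eq0.
have := L0 _ (WD _ _ Wu (WL _ Wu)).
rewrite linearD metricDl !metricDr (L0 _ Wu) (L0 _ (WL _ Wu)).
by rewrite [g x (L (L u)) u]Lsym; lra.
Qed.

(** The cosine of an angle between [u] and [W] lies in [[0, 1]], so that [acos]
    can be inverted, and equals 1 only for the angle 0. *)
Lemma angle_subspace_cos u (W : set (tangent M x)) (theta : R) :
  u != 0 -> angle_subspace (g x) u W theta -> theta != 0 ->
  exists w, [/\ W w, forall w', W w' -> g x (u - w) w' = 0,
    g x w w = cos theta ^+ 2 * g x u u & cos theta ^+ 2 != 1].
Proof.
move=> u0 [w [Ww wP] ->] th0; exists w.
have guu := metric_pos g u0.
have gww := metric_ge0 w.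
have leu : g x w w <= g x u u.
  have := metric_ge0 (u - w); have := wP _ Ww.
  by rewrite metricBr !metricBl (metricC w u); lra.
set r := _ / _ in th0 *.
have r0 : 0 <= r by rewrite divr_ge0 ?sqrtr_ge0.
have r1 : r <= 1 by rewrite ler_pdivrMr ?sqrtr_gt0// mul1r ler_wsqrtr.
have cosr : cos (acos r) = r.
  by rewrite acosK// in_itv/= r1 andbT (le_trans _ r0)// lerN10.
split=> //.
- by rewrite cosr expr_div_n !sqr_sqrtr ?(ltW guu)// divfK// gt_eqF.
- rewrite cosr; apply: contraNneq th0 => /eqP.
  by rewrite sqrf_eq1 => /orP[/eqP->|/eqP rN1]; [rewrite acos1|move: r0; lra].
Qed.

End metric.

Lemma dist_linear (R : realType) (n : nat) (M : manifold R n)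
    (E : smooth_distribution M) (x : M) (a : R) (u v : tangent M x) :
  E x u -> E x v -> E x (a *: u + v).
Proof.
have [F /nbhs_singleton[_ ->]] := dist_frame E x.
move=> [b ->] [c ->]; exists (fun i => a * b i + c i).
rewrite scaler_sumr -big_split; apply: eq_bigr => i _ /=.
by rewrite scalerDl scalerA.
Qed.

(** * Solution spaces of quadratic equations in an endomorphism *)

(** The scalar [a] tells the two distributions apart: 1 on the invariant one,
    [cos theta ^+ 2] on the slant one.  All coefficients are constant, so that
    for a parallel [T] the equation survives covariant differentiation. *)
Definition quad_eigen {R : realType} {V : lmodType R} (T : V -> V) (p q a : R)
  : set V := [set u | T (T u) = a *: (p *: T u + q *: u)].

Section quad_eigen.
Context {R : realType} {V : lmodType R} (T : {linear V -> V}).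
Variables p q : R.
Hypothesis q0 : q != 0.

Lemma quad_eigen_sub a u v : quad_eigen T p q a u -> quad_eigen T p q a v ->
  quad_eigen T p q a (u - v).
Proof.
rewrite /quad_eigen/= => Tu Tv; rewrite !(linearB T) Tu Tv -scalerBr.
by congr (_ *: _); rewrite !scalerBr opprD addrACA.
Qed.

(** Two such equations give [p T u + q u = 0] and [T^2 u = 0]; applying [T] to
    the former gives [T u = 0], and then [u = 0]. *)
Lemma quad_eigen_trivial a b u : a != b ->
  quad_eigen T p q a u -> quad_eigen T p q b u -> u = 0.
Proof.
rewrite /quad_eigen/= => ab Ta Tb.
have Q0 : p *: T u + q *: u = 0.
  apply/eqP; have /eqP := etrans (esym Ta) Tb.
  by rewrite -subr_eq0 -scalerBl scaler_eq0 subr_eq0 (negPf ab).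
have TT0 : T (T u) = 0 by rewrite Ta Q0 scaler0.
have Tu0 : T u = 0.
  have := congr1 T Q0; rewrite linear0 linearD !linearZ/= TT0 scaler0 add0r.
  by move/eqP; rewrite scaler_eq0 (negPf q0) => /eqP.
move: Q0; rewrite Tu0 scaler0 add0r => /eqP.
by rewrite scaler_eq0 (negPf q0) => /eqP.
Qed.

(** If [u = v + v'] solves the equation for [a], then so does [v' = u - v],
    which also solves the one for [b] and therefore vanishes. *)
Lemma mem_quad_eigen (W W' : set V) a b : a != b ->
  (forall u, exists v v', [/\ W v, W' v' & u = v + v']) ->
  W `<=` quad_eigen T p q a -> W' `<=` quad_eigen T p q b ->
  W = quad_eigen T p q a.
Proof.
move=> ab span WT WT'; apply/seteqP; split=> // u Tu.
have [v [v' [Wv Wv' uE]]] := span u.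
suff v'0 : v' = 0 by rewrite uE v'0 addr0.
apply: (quad_eigen_trivial ab); last exact: WT'.
have -> : v' = u - v by rewrite uE addrC addKr.
by apply: quad_eigen_sub => //; exact: WT.
Qed.

End quad_eigen.

(** * Covariant differentiation of the quadratic equation *)

Section connection_constants.
Context {R : realType} {n : nat} {M : manifold R n}.

Lemma derivation_cst x (v : tangent M x) (a : R) : v (sf_cst M a) = 0.
Proof.
have [_ vZ vM] := tvP v.
have v1 : v 1 = 0.
  have := vM 1 1; rewrite mulr1 !mul1r => /eqP.
  by rewrite -subr_eq subrr eq_sym => /eqP.
by have := vZ a 1; rewrite mulr1 v1 mulr0.
Qed.

Lemma nablaZ (D : connection M) (X Y : vfield M) (a : R) :
  D X (sf_cst M a *: Y) = sf_cst M a *: D X Y.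
Proof.
rewrite nabla_leibniz [vf_app _ _](_ : _ = 0) ?scale0r ?add0r//.
by apply: smoothFun_eq => x /=; rewrite derivation_cst.
Qed.

End connection_constants.

Section parallel_quad_eigen.
Context {R : realType} {n : nat} {M : manifold R n}.
Variables (D : connection M) (T : tensor11 M).
Hypothesis T_parallel : parallel D T.

Lemma parallel_nabla X Y : D X (t11_app T Y) = t11_app T (D X Y).
Proof. by apply/eqP; rewrite -subr_eq0; apply/eqP; exact: T_parallel. Qed.

(** A parallel [T] commutes with [D_X], so the defining equation can be
    differentiated termwise. *)
Lemma nabla_quad_eigen p q a (X Y : vfield M) :
  (forall x, quad_eigen (T x) p q a (Y x)) ->
  forall x, quad_eigen (T x) p q a (D X Y x).
Proof.
move=> TY.
have TYE : t11_app T (t11_app T Y) =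
    sf_cst M a *: (sf_cst M p *: t11_app T Y + sf_cst M q *: Y).
  by apply: vfield_eq => x; exact: TY.
have := congr1 (D X) TYE.
rewrite nablaZ nabla_add !nablaZ !parallel_nabla => DTY x.
exact: (congr1 (fun Z : vfield M => Z x) DTY).
Qed.

Lemma quad_eigen_integrable (g : riemannian_metric M) p q a
    (E : smooth_distribution M) :
  levi_civita g D -> (forall x, E x = quad_eigen (T x) p q a) ->
  integrable_distribution E.
Proof.
move=> [torsion_free _] ET X Y EX EY x; rewrite -torsion_free ET.
have -> : (D X Y - D Y X) x = D X Y x - D Y X x.
  change (D X Y x + (- 1 : R) *: D Y X x = D X Y x - D Y X x).
  by rewrite scaleN1r.
by apply: quad_eigen_sub; apply: nabla_quad_eigen => y; rewrite -ET.
Qed.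

End parallel_quad_eigen.

(** * The tangential part on the two distributions *)

Section semi_slant_pointwise.
Context {R : realType} {p q m m' : nat}.
Context {Mbar : manifold R m} {gbar : riemannian_metric Mbar} {J : tensor11 Mbar}.
Context {M : manifold R m'} {g : riemannian_metric M}.
Context {phi : smoothMap M Mbar} {T : tensor11 M}.
Context {D1 D2 : smooth_distribution M} {theta : R}.
Hypothesis q_gt0 : (0 < q)%N.
Hypothesis J_metallic : metallic p q gbar J.
Hypothesis phi_immersion : isometric_immersion g gbar phi.
Hypothesis T_tangential : tangential_part gbar J phi T.
Hypothesis M_semi_slant : semi_slant g gbar J phi D1 D2 theta.

Local Notation dphi := (differential phi).

Lemma tangentialE x (u v : tangent M x) :
  gbar (phi x) (J (phi x) (dphi u)) (dphi v) = g x (T x u) v.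
Proof.
have [_ iso] := phi_immersion; apply/eqP.
by rewrite iso -subr_eq0 -metricBl T_tangential.
Qed.

Lemma tangential_sym x (u v : tangent M x) : g x (T x u) v = g x u (T x v).
Proof.
have [_ Jsym] := J_metallic.
by rewrite -tangentialE Jsym metricC tangentialE metricC.
Qed.

Lemma metallic_norm x (u : tangent M x) :
  gbar (phi x) (J (phi x) (dphi u)) (J (phi x) (dphi u)) =
  g x (p%:R *: T x u + q%:R *: u) u.
Proof.
have [J2 Jsym] := J_metallic; have [_ iso] := phi_immersion.
rewrite Jsym J2 metricC !metricDl !metricZl tangentialE.
by rewrite (iso x u u).
Qed.

Lemma metallic_neq0 x (u : tangent M x) : u != 0 -> J (phi x) (dphi u) != 0.
Proof.
have [J2 _] := J_metallic; have [inj _] := phi_immersion.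
apply: contraNneq => Ju0; apply/eqP/inj; rewrite linear0.
have := J2 _ (dphi u); rewrite Ju0 linear0 scaler0 add0r => /esym/eqP.
by rewrite scaler_eq0 pnatr_eq0 gtn_eqF// => /eqP.
Qed.

(** Since [J u] is tangent, it is its own tangential part. *)
Lemma tangential_invariant x (u : tangent M x) : D1 x u ->
  D1 x (T x u) /\ dphi (T x u) = J (phi x) (dphi u).
Proof.
have [_ _ invD1 _ _] := M_semi_slant => D1u.
have [w D1w wE] : (@differential _ _ _ _ _ phi x @` D1 x) (J (phi x) (dphi u)).
  by rewrite -invD1; exists (dphi u) => //; exists u.
suff -> : T x u = w by [].
apply/eqP; rewrite -subr_eq0; apply/eqP/(@metric_eq0 _ _ _ g).
by rewrite metricBl -tangentialE -wE; have [_ <-] := phi_immersion; rewrite subrr.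
Qed.

Lemma invariant_quad_eigen x : D1 x `<=` quad_eigen (T x) p%:R q%:R 1.
Proof.
move=> u D1u; have [J2 _] := J_metallic; have [inj _] := phi_immersion.
have [D1Tu TuE] := tangential_invariant D1u.
have [_ TTuE] := tangential_invariant D1Tu.
apply: inj; rewrite scale1r TTuE TuE J2.
by rewrite linearD !linearZ/= TuE.
Qed.

(** By symmetry of [T] and invariance of [D1], [T u] is orthogonal to [D1]. *)
Lemma tangential_slant x (u : tangent M x) : D2 x u -> D2 x (T x u).
Proof.
have [ortho dec _ _ _] := M_semi_slant => D2u.
have [[a b] [[/= D1a D2b TuE] _]] := dec x (T x u).
suff a0 : a = 0 by rewrite TuE a0 add0r.
have [D1Ta _] := tangential_invariant D1a.
have := ortho _ _ _ D1Ta D2u; rewrite tangential_sym TuE metricDr.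
by rewrite (ortho _ _ _ D1a D2b) addr0 => /metric_eq0.
Qed.

(** [T u] is the projection of [J u] onto [D2]: its difference with that
    projection is orthogonal to [D2], and lies in [D2] since [T u] does. *)
Lemma slant_norm x (u : tangent M x) : D2 x u -> u != 0 ->
  g x (T x u) (T x u) = cos theta ^+ 2 * g x (p%:R *: T x u + q%:R *: u) u
  /\ cos theta ^+ 2 != 1.
Proof.
have [_ _ _ slant th0] := M_semi_slant => D2u u0.
have [_ [[w D2w <-] wP wE c1]] :=
  angle_subspace_cos (metallic_neq0 u0) (slant _ _ D2u u0) th0.
have [_ iso] := phi_immersion; split=> //.
rewrite -metallic_norm -wE -iso; suff -> : T x u = w by [].
apply/eqP; rewrite -subr_eq0; apply/eqP/(@metric_eq0 _ _ _ g).
have D2d : D2 x (T x u - w).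
  by rewrite addrC -scaleN1r; apply: dist_linear => //; exact: tangential_slant.
have := wP (dphi (T x u - w)); rewrite metricBl tangentialE -iso -metricBl.
by apply; exists (T x u - w).
Qed.

(** When [D2] vanishes, [theta] is unconstrained and [cos theta ^+ 2] may be 1;
    the inclusion then holds for every [c], and 0 is taken. *)
Lemma slant_quad_eigen :
  exists2 c : R, c != 1 & forall x, D2 x `<=` quad_eigen (T x) p%:R q%:R c.
Proof.
have [[x [u [D2u u0]]]|D20] :=
    pselect (exists x (u : tangent M x), D2 x u /\ u != 0); last first.
  exists 0; first by rewrite eq_sym oner_neq0.
  move=> x u D2u; have -> : u = 0.
    by apply/eqP/negP => /negP u0; apply: D20; exists x, u.
  by rewrite /quad_eigen/= !linear0 addr0 scaler0.
exists (cos theta ^+ 2) => [|{u D2u u0}{}x u D2u].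
  by have [] := slant_norm D2u u0.
set c := cos theta ^+ 2.
(* [L] measures the failure of the equation; its quadratic form vanishes on
   [D2] by [slant_norm]. *)
pose L : {linear tangent M x -> tangent M x} :=
  (T x \o T x) \- (c \*: (p%:R \*: T x \+ q%:R \*: idfun)).
have LE v : L v = T x (T x v) - c *: (p%:R *: T x v + q%:R *: v) by [].
apply/eqP; rewrite -subr_eq0 -LE; apply/eqP.
apply: (symmetric_form_eq0 (g := g) (W := D2 x)) D2u => [v w|v|v w|v D2v].
- by rewrite -[X in _ -> _ -> D2 x (X + _)]scale1r; exact: dist_linear.
- move=> D2v; have D2Tv := tangential_slant D2v.
  have -> : L v = (- c * p%:R) *: T x v + ((- c * q%:R) *: v + T x (T x v)).
    by rewrite LE scalerDr opprD !scalerA !mulNr !scaleNr addrC addrA.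
  apply: dist_linear => //; apply: dist_linear => //; exact: tangential_slant.
- rewrite !LE metricBl metricBr metricZl metricZr metricDl metricDr.
  by rewrite !metricZl !metricZr !tangential_sym.
- rewrite LE metricBl metricZl tangential_sym.
  have [->|v0] := eqVneq v 0.
    rewrite linear0 !metric0l [p%:R *: _]scaler0 scaler0 addr0 metric0l.
    by rewrite mulr0 subr0.
  by have [-> _] := slant_norm D2v v0; rewrite subrr.
Qed.

End semi_slant_pointwise.

Theorem theorem4 (R : realType) (p q m m' : nat)
  (Mbar : manifold R m) (gbar : riemannian_metric Mbar) (J : tensor11 Mbar)
  (Dbar : connection Mbar)
  (M : manifold R m') (g : riemannian_metric M) (D : connection M)
  (phi : smoothMap M Mbar) (T : tensor11 M)
  (D1 D2 : smooth_distribution M) (theta : R)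
  (p_gt0 : (0 < p)%N) (q_gt0 : (0 < q)%N)
  (m'_gt0 : (0 < m')%N) (m'_lt_m : (m' < m)%N)
  (Mbar_metallic : locally_metallic p q gbar J Dbar)
  (phi_immersion : isometric_immersion g gbar phi)
  (D_levi_civita : levi_civita g D)
  (T_tangential : tangential_part gbar J phi T)
  (M_semi_slant : semi_slant g gbar J phi D1 D2 theta)
  (T_parallel : parallel D T) :
  integrable_distribution D1 /\ integrable_distribution D2.
Proof.
have [J_metallic _ _] := Mbar_metallic.
have D1T := invariant_quad_eigen J_metallic phi_immersion T_tangential M_semi_slant.
have [c c1 D2T] :=
  slant_quad_eigen q_gt0 J_metallic phi_immersion T_tangential M_semi_slant.
have q0 : q%:R != 0 :> R by rewrite pnatr_eq0 -lt0n.
have [_ dec _ _ _] := M_semi_slant.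
split.
- apply: (quad_eigen_integrable T_parallel D_levi_civita) => x.
  apply: (mem_quad_eigen q0) (D1T x) (D2T x); first by rewrite eq_sym.
  by move=> u; have [[v v'] [[D1v D2v' ->] _]] := dec x u; exists v, v'.
- apply: (quad_eigen_integrable T_parallel D_levi_civita) => x.
  apply: (mem_quad_eigen q0 c1) (D2T x) (D1T x) => u.
  have [[v v'] [[D1v D2v' ->] _]] := dec x u.
  by exists v', v; split=> //; rewrite addrC.
Qed.
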